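(* Let $F$ be a finite nonempty set with $N=|F|$ and let $P_\theta$, $\theta\in F$, be probability measures on a sample space $\mathcal X$ having densities $p_\theta$ with respect to a sigma-finite measure $\mu$. Let $Q_\alpha$, $\alpha\in G$, be $M:=|G|$ probability measures ($G$ a finite nonempty set) having densities $q_\alpha$, $\alpha\in G$, with respect to $\mu$, and let $j:F\to G$ be a mapping. For every convex function $f:[0,\infty)\to\mathbb R$, $$J_f\ \le\ \frac1N\sum_{\theta\in F}\int_{\mathcal X}\frac{q_{j(\theta)}}{M}\,f\left(\frac{Mp_\theta}{q_{j(\theta)}}\right)d\mu+\left(1-\frac1M\right)f(0).$$
   Context: For a convex function $f:[0,\infty)\to\mathbb R$ and probability measures $P,Q$ on $\mathcal X$, $D_f(P\|Q):=\int f\left(\frac{dP}{dQ}\right)dQ$ if $P$ is absolutely continuous with respect to $Q$, and $D_f(P\|Q):=\infty$ otherwise. The quantity $J_f$ is $$J_f:=\inf_Q\frac1N\sum_{\theta\in F}D_f(P_\theta\|Q),$$ the infimum being over all probability measures $Q$ on $\mathcal X$. Convention, consistent with the definition of $D_f$: the integral $\int_{\mathcal X}\frac{q_{j(\theta)}}{M}f\left(\frac{Mp_\theta}{q_{j(\theta)}}\right)d\mu$ is taken over $\{q_{j(\theta)}>0\}$ if $P_\theta$ is absolutely continuous with respect to $Q_{j(\theta)}$, and is read as $+\infty$ otherwise. *)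

(* Defs.v *)
From HB Require Import structures.
From mathcomp Require Import all_boot all_order all_algebra.
From mathcomp Require Import all_classical all_reals all_analysis.

Set Implicit Arguments.
Unset Strict Implicit.
Unset Printing Implicit Defensive.

Import Order.TTheory GRing.Theory Num.Theory.
Import numFieldNormedType.Exports.

Local Open Scope classical_set_scope.
Local Open Scope ring_scope.
Local Open Scope ereal_scope.

Definition is_density d (T : measurableType d) (R : realType)
    (mu : {measure set T -> \bar R}) (P : set T -> \bar R) (p : T -> R) : Prop :=
  [/\ measurable_fun [set: T] p,
      forall x, (0 <= p x)%R &
      forall A, measurable A -> P A = \int[mu]_(x in A) (p x)%:E].

(* A function [0, oo) -> R is represented by a function on R that is only
   constrained on [0, oo). *)
Definition convex_on_nonneg (R : realType) (f : R -> R) : Prop :=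
  @convex_function R R^o [set x : R | (0 <= x)%R] f.

(* [Radon_Nikodym_SigmaFinite.f P Q] is the derivative dP/dQ; when P << Q it is
   finite and nonnegative everywhere, so f is evaluated on [0, oo) only. *)
Definition fdivergence d (T : measurableType d) (R : realType)
    (f : R -> R) (P Q : probability T R) : \bar R :=
  if `[< P `<< Q >]
  then \int[Q]_x (f (fine (Radon_Nikodym_SigmaFinite.f P Q x)))%:E
  else +oo.

Definition Jf d (T : measurableType d) (R : realType) (F : finType)
    (f : R -> R) (P : F -> probability T R) : \bar R :=
  ereal_inf [set (#|F|%:R^-1)%:E * \sum_(theta : F) fdivergence f (P theta) Q
            | Q in [set: probability T R]].

(* The integral of (q / M) f (M p / q) with respect to mu, where p and q are
   densities of P and Q: it is taken over {q > 0} when P << Q, and is read as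
   +oo otherwise. *)
Definition scaled_fdivergence d (T : measurableType d) (R : realType)
    (mu : {measure set T -> \bar R}) (f : R -> R) (M : nat)
    (P Q : probability T R) (p q : T -> R) : \bar R :=
  if `[< P `<< Q >]
  then \int[mu]_(x in [set x | (0 < q x)%R])
         (q x / M%:R * f (M%:R * p x / q x))%:E
  else +oo.

(* Main.v *)
Require Import Defs.
From HB Require Import structures.
From mathcomp Require Import all_boot all_order all_algebra.
From mathcomp Require Import all_classical all_reals all_analysis.
From mathcomp Require Import measurable_realfun ring lra.

(* The mixture m = (1/M) sum_alpha Q_alpha, with density h, is a candidate for
   the infimum. Since q_j <= M h, the ratio p / h is the convex combination
   of M p / q_j and 0 with weights q_j / (M h) and 1 - q_j / (M h); convexity
   of f, multiplication by h and integration give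
     D_f(P || m) <= int (q_j / M) f (M p / q_j) dmu + (1 - 1/M) f 0
   for every theta. As f may be negative, the inequality is first integrated
   for the nonnegative convex function f x + C (1 + x), and the affine part,
   which is integrable on both sides, is subtracted afterwards. *)

Set Implicit Arguments.
Unset Strict Implicit.
Unset Printing Implicit Defensive.

Import Order.TTheory GRing.Theory Num.Theory.
Import numFieldNormedType.Exports.

Local Open Scope classical_set_scope.
Local Open Scope ring_scope.
Local Open Scope ereal_scope.

(** * Convex functions on the half-line *)

Section convex_on_nonneg.
Variable R : realType.
Implicit Types f : R -> R.
Local Open Scope ring_scope.

Lemma convex_on_nonnegP f :
  convex_on_nonneg f <->
  forall t x y, 0 <= t -> t <= 1 -> 0 <= x -> 0 <= y ->
    f (t * x + (1 - t) * y) <= t * f x + (1 - t) * f y.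
Proof.
split=> [cf t x y t0 t1 x0 y0|cf t x y].
  have t01 : Itv.spec (@Itv.num_sem _) (Itv.Real `[0%Z, 1%Z]) t.
    by apply/and3P; split; rewrite ?num_real//= in_itv/= t0.
  by have := cf (Itv.mk t01) x y; rewrite !inE; apply.
by rewrite !inE/= => x0 y0; apply: cf.
Qed.

Lemma convex_on_nonneg_affine f (C : R) :
  convex_on_nonneg f -> convex_on_nonneg (fun x => f x + C * (1 + x)).
Proof.
move=> /convex_on_nonnegP cf; apply/convex_on_nonnegP => t x y t0 t1 x0 y0.
by have := cf t x y t0 t1 x0 y0; lra.
Qed.

(* Comparing f 1 with the chords over [0, x] (if 1 <= x) and [x, 2] (if x <= 1). *)
Lemma convex_on_nonneg_ge f : convex_on_nonneg f ->
  exists2 C : R, 0 <= C & forall x, 0 <= x -> 0 <= f x + C * (1 + x).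
Proof.
move=> /convex_on_nonnegP cf.
(* The chords give [(2 - x) f 1 <= f x + (1 - x) f 2] for [x <= 1] and [x f 1 <= f x + (x - 1) f 0]
   for [x >= 1]. The coefficients of [f 1], [f 2] and [f 0] are at most [2 (1 + x)], [1 + x] and
   [1 + x]. *)
exists (2 * `|f 1| + `|f 0| + `|f 2|) => [|x x0].
  by rewrite !addr_ge0 ?mulr_ge0.
have [/andP[a1 b1] [/andP[a0 b0] /andP[a2 b2]]] :
    (- `|f 1| <= f 1 <= `|f 1|) /\
    (- `|f 0| <= f 0 <= `|f 0|) /\ (- `|f 2| <= f 2 <= `|f 2|).
  by rewrite -!ler_norml.
move: (`|f 1|) (`|f 0|) (`|f 2|) a1 b1 a0 b0 a2 b2 => A1 A0 A2 *.
have [x1|x1] := leP x 1.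
  have s : 0 < 2 - x by lra.
  have := cf ((2 - x)^-1) x 2.
  have -> : (2 - x)^-1 * x + (1 - (2 - x)^-1) * 2 = 1 by field; lra.
  rewrite invr_ge0 invf_le1//; do 4 (move/(_ ltac:(lra))).
  rewrite -(ler_pM2l s).
  rewrite [leRHS](_ : _ = f x + (1 - x) * f 2); last by field; lra.
  by nra.
have s : 0 < x by lra.
have := cf (x^-1) x 0.
have -> : x^-1 * x + (1 - x^-1) * 0 = 1 by field; lra.
rewrite invr_ge0 invf_le1//; do 4 (move/(_ ltac:(lra))).
rewrite -(ler_pM2l s).
rewrite [leRHS](_ : _ = f x + (x - 1) * f 0); last by field; lra.
by nra.
Qed.

(** Between two points a convex function stays below the larger of its two values there, so its
    strict sublevel sets are intervals; the rays []-oo, r[] generate the Borel sets. *)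
Lemma convex_on_nonneg_measurable f : convex_on_nonneg f ->
  @measurable_fun _ _ R R `[0, +oo[ f.
Proof.
move=> /convex_on_nonnegP cf mD.
apply: (measurability _ (RGenInftyO.measurableE R)) => // _ [_ [r ->] <-].
apply: is_interval_measurable => x y /=.
rewrite !in_itv/= !andbT => -[x0 fx] [y0 fy] z /andP[xz zy].
rewrite !in_itv/= andbT; split; first exact: le_trans xz.
have [xy|xy] := eqVneq x y.
  by have -> : z = x by apply/le_anti; rewrite xz xy zy.
have {}xy : 0 < y - x by rewrite subr_gt0 lt_neqAle xy (le_trans xz zy).
have t0 : 0 <= (y - z) / (y - x) by rewrite divr_ge0 ?(ltW xy)// subr_ge0.
have t1 : (y - z) / (y - x) <= 1 by rewrite ler_pdivrMr//; lra.
have := cf ((y - z) / (y - x)) x y t0 t1 x0 y0.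
rewrite [X in f X](_ : _ = z); last by field; lra.
move: t0 t1; set t := _ / _ => t0 t1 /le_lt_trans; apply.
apply: (@le_lt_trans _ _ (Num.max (f x) (f y))); last by rewrite gt_max fx fy.
have : f x <= Num.max (f x) (f y) by rewrite le_max lexx.
have : f y <= Num.max (f x) (f y) by rewrite le_max lexx orbT.
move: (Num.max _ _) => m *.
by nra.
Qed.

(* Convexity between [M p / q] and [0], since
   [p / h = (q / (M h)) (M p / q) + (1 - q / (M h)) 0]. *)
Lemma perspective_le f (M p q h r : R) : convex_on_nonneg f -> 0 < M ->
  0 <= p -> 0 <= q -> q <= M * h -> (q = 0 -> p = 0) -> r * h = p ->
  f r * h <= (if 0 < q then q / M * f (M * p / q) else 0)
             + (h - q / M) * f 0.
Proof.
move=> /convex_on_nonnegP cf M0 p0 q0 qh qp rh.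
(* Where [h = 0] the value of [r] is arbitrary, but both sides vanish. *)
have [h0|h0] := eqVneq h 0.
  have -> : q = 0 by apply/le_anti; rewrite q0 (le_trans qh)// h0 mulr0.
  by rewrite ltxx h0; lra.
have hp : 0 < h.
  by rewrite lt_neqAle eq_sym h0 -(pmulr_rge0 _ M0) (le_trans q0).
have -> : r = p / h by rewrite -rh mulfK.
case: ltP => [q1|q1]; last first.
  (* Here [p = 0] too, so both sides equal [h * f 0]. *)
  have q00 : q = 0 by apply/le_anti; rewrite q0 q1.
  by rewrite qp// q00 !mul0r; lra.
have Mh : 0 < M * h by rewrite mulr_gt0.
have t0 : 0 <= q / (M * h) by rewrite divr_ge0// ltW.
have t1 : q / (M * h) <= 1 by rewrite ler_pdivrMr// mul1r.
have x0 : 0 <= M * p / q by rewrite divr_ge0// mulr_ge0// ltW.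
have := cf _ _ 0 t0 t1 x0 (lexx _).
rewrite [X in f X <= _](_ : _ = p / h); last first.
  by field; rewrite !lt0r_neq0.
rewrite -(ler_pM2r hp) => /le_trans; apply.
by rewrite le_eqVlt; apply/orP; left; apply/eqP; field; rewrite !lt0r_neq0.
Qed.

End convex_on_nonneg.

(** * Subtracting an integrable function under the integral *)

Section integral.
Context d (T : measurableType d) (R : realType).
Variable mu : {measure set T -> \bar R}.

(** The point is the case where [u] has infinite integral. Then [w = u - v] satisfies [w^- <= v], so
    [w^-] has finite integral, while [u <= w^+ + v] forces the integral of [w^+] to be infinite;
    both sides are [+oo]. *)
Lemma integralB_nneg D (u v : T -> R) : measurable D ->
  measurable_fun D u -> (forall x, D x -> (0 <= v x)%R) ->
  mu.-integrable D (EFin \o v) -> (forall x, D x -> (0 <= u x)%R) ->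
  \int[mu]_(x in D) (u x - v x)%:E =
  \int[mu]_(x in D) (u x)%:E - \int[mu]_(x in D) (v x)%:E.
Proof.
move=> mD mfu v0 iv u0; have mv := measurable_int _ iv.
have mu1 : measurable_fun D (EFin \o u) by exact/measurable_EFinP.
have vfin := integrable_fin_num mD iv.
have [ufin|] := ltP (\int[mu]_(x in D) (u x)%:E) +oo.
  have iu : mu.-integrable D (EFin \o u).
    apply/integrableP; split => //.
    by under eq_integral => x /[!inE] Dx do rewrite /= ger0_norm ?u0//.
  by rewrite -(integralB_EFin mD iu iv).
rewrite leye_eq => /eqP uoo; rewrite uoo.
set w := fun x => (u x - v x)%:E.
have mw : measurable_fun D w.
  by apply/measurable_EFinP/measurable_funB => //; exact/measurable_EFinP.
have wn : \int[mu]_(x in D) w^\- x <= \int[mu]_(x in D) (v x)%:E.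
  apply: ge0_le_integral => //; first exact: measurable_funeneg.
  move=> x Dx; rewrite funenegE /w/= -EFin_max lee_fin.
  by rewrite ge_max v0// andbT; have := u0 _ Dx; lra.
have wp : \int[mu]_(x in D) w^\+ x = +oo.
  have : +oo <= \int[mu]_(x in D) w^\+ x + \int[mu]_(x in D) (v x)%:E.
    rewrite -ge0_integralD//; last exact: measurable_funepos.
    rewrite -uoo; apply: ge0_le_integral => //.
    - by apply: emeasurable_funD => //; exact: measurable_funepos.
    - move=> x Dx; rewrite funeposE /w/= -EFin_max -EFinD lee_fin.
      by rewrite -lerBlDr le_max lexx.
  move: vfin; case: (\int[mu]_(x in D) (v x)%:E) => //= a _.
  by case: (\int[mu]_(x in D) w^\+ x).
rewrite integralE wp.
have : \int[mu]_(x in D) w^\- x < +oo.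
  by rewrite (le_lt_trans wn)// ltey_eq vfin.
move: vfin; case: (\int[mu]_(x in D) (v x)%:E) => //= a _.
by case: (\int[mu]_(x in D) w^\- x).
Qed.

End integral.

(** * Densities and Radon-Nikodym derivatives *)

Section density.
Context d (T : measurableType d) (R : realType).
Variable mu : {sigma_finite_measure set T -> \bar R}.
Implicit Types (P Q : probability T R) (p q : T -> R).

Lemma probability_of_density (h : T -> R) :
  measurable_fun [set: T] h ->
  (forall x, (0 <= h x)%R) -> \int[mu]_x (h x)%:E = 1 ->
  exists P : probability T R, is_density mu P h.
Proof.
move=> mh h0 h1; pose nu A := \int[mu]_(x in A) (h x)%:E.
have nu0 : nu set0 = 0 by rewrite /nu integral_set0.
have nu_ge0 A : 0 <= nu A by apply: integral_ge0 => x _; rewrite lee_fin.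
have nuS : semi_sigma_additive nu.
  apply: semi_sigma_additive_nng_induced => [|x]; last by rewrite lee_fin.
  exact/measurable_EFinP.
pose m1 := isMeasure.Build d T R nu nu0 nu_ge0 nuS.
pose nu' : {measure set T -> \bar R} := HB.pack nu m1.
pose m2 := Measure_isProbability.Build d T R nu' h1.
pose P : probability T R := HB.pack nu m1 m2.
by exists P.
Qed.

Lemma density_integrable P p :
  is_density mu P p -> mu.-integrable [set: T] (EFin \o p).
Proof.
move=> [mp p0 pP]; apply/integrableP; split; first exact/measurable_EFinP.
under eq_integral do rewrite /= ger0_norm//.
by rewrite -pP// probability_setT ltry.
Qed.

Lemma density_dominates P p : is_density mu P p -> P `<< mu.
Proof.
move=> [mp p0 pP]; apply/null_content_dominatesP => A mA A0.
by rewrite pP// null_set_integral//; exact/measurable_funTS/measurable_EFinP.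
Qed.

(** Both functions have integral [P E] over every measurable [E]. *)
Lemma ae_density P p : is_density mu P p ->
  ae_eq mu [set: T] (EFin \o p) (Radon_Nikodym_SigmaFinite.f P mu).
Proof.
move=> dP; have [mp p0 pP] := dP; have Pmu := density_dominates dP.
apply: integral_ae_eq => //; first exact: density_integrable dP.
- exact: measurable_int (Radon_Nikodym_SigmaFinite.f_integrable Pmu).
- by move=> E _ mE; rewrite -pP// -Radon_Nikodym_SigmaFinite.f_integral.
Qed.

(** The set where [q] vanishes is [Q]-null, hence [P]-null, so the nonnegative [p] has integral zero
    over it. *)
Lemma ae_density_eq0 P Q p q : is_density mu P p -> is_density mu Q q ->
  P `<< Q -> {ae mu, forall x, q x = 0%R -> p x = 0%R}.
Proof.
move=> [mp p0 pP] [mq q0 qQ] /null_content_dominatesP PQ.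
pose Z := q @^-1` [set 0%R].
have mZ : measurable Z by rewrite -[Z]setTI; exact: mq.
have PZ : P Z = 0.
  by apply: PQ => //; apply: (etrans (qQ _ mZ)); apply: integral0_eq => x ->.
have mpZ : measurable_fun Z (EFin \o p).
  exact/measurable_funTS/measurable_EFinP.
have [+ _] := ae_eq_integral_abs mu mZ mpZ.
under eq_integral do rewrite /= ger0_norm//.
rewrite -pP// => /(_ PZ); apply: filterS => x /= /[apply].
by case.
Qed.

Lemma ge0_integral_density P p (g : T -> \bar R) : is_density mu P p ->
  measurable_fun [set: T] g -> (forall x, 0 <= g x) ->
  \int[P]_x g x = \int[mu]_x (g x * (p x)%:E).
Proof.
move=> dP mg g0; have [mp p0 pP] := dP; have Pmu := density_dominates dP.
rewrite -(Radon_Nikodym_SigmaFinite.change_of_variables Pmu)//.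
apply: ae_eq_integral => //.
- apply: emeasurable_funM => //.
  exact: measurable_int (Radon_Nikodym_SigmaFinite.f_integrable Pmu).
- by apply: emeasurable_funM => //; exact/measurable_EFinP.
- by apply: ae_eqe_mul2l; exact/ae_eq_sym/ae_density.
Qed.

(** Chain rule for [P << Q << mu], with the two derivatives with respect to [mu] replaced by the
    given densities; [fine] loses nothing since dP/dQ is finite everywhere. *)
Lemma ae_density_chain P Q p q (r := fine \o Radon_Nikodym_SigmaFinite.f P Q) :
  is_density mu P p -> is_density mu Q q -> P `<< Q ->
  {ae mu, forall x, (r x * q x = p x)%R}.
Proof.
move=> dP dQ PQ.
have := Radon_Nikodym_SigmaFinite.chain_rule PQ (density_dominates dQ)
  measurableT.
have := ae_density dQ; have := ae_density dP.
apply: filterS3 => x /= /(_ I) p1 /(_ I) q1 /(_ I) pq1.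
apply: EFin_inj; rewrite p1 pq1 EFinM q1 /r /= fineK//.
exact: Radon_Nikodym_SigmaFinite.f_fin_num.
Qed.

End density.

(** * The bound for one pair [P], [Q], knowing only [q <= M h] about the mixture *)

Section fdivergence.
Context d (T : measurableType d) (R : realType).
Variable mu : {sigma_finite_measure set T -> \bar R}.
Variables (P Q m : probability T R) (p q h : T -> R).
Hypotheses (Pp : is_density mu P p) (Qq : is_density mu Q q).
Hypothesis mh : is_density mu m h.
Variable M : nat.
Hypotheses (M_gt0 : (0 < M)%N) (qh : forall x, (q x <= M%:R * h x)%R).
Implicit Types f : R -> R.

Let MR_gt0 : (0 < M%:R :> R)%R. Proof. by rewrite ltr0n. Qed.

Let r := fine \o Radon_Nikodym_SigmaFinite.f P m.

Let D := [set x | (0 < q x)%R].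

Let mD : measurable D.
Proof.
have [mq _ _] := Qq; rewrite [D](_ : _ = q @^-1` `]0%R, +oo[).
  by rewrite -[X in measurable X]setTI; exact: mq.
by apply/seteqP; split=> x /=; rewrite in_itv/= andbT.
Qed.

(** Integrating [q <= M h] over [A] gives [Q A <= M * m A]. *)
Lemma dominated_scaled_density : Q `<< m.
Proof.
have [mq q0 qQ] := Qq; have [mh' h0 hm] := mh.
apply/null_content_dominatesP => A mA mA0; apply/eqP.
rewrite eq_le measure_ge0 andbT qQ//.
apply: (@le_trans _ _ (\int[mu]_(x in A) (M%:R%:E * (h x)%:E))).
  apply: ge0_le_integral => //.
  - by move=> x _; rewrite lee_fin.
  - exact/measurable_funTS/measurable_EFinP.
  - by apply/measurable_funTS/measurable_EFinP/measurable_funM.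
  - by move=> x _; rewrite -EFinM lee_fin.
rewrite ge0_integralZl//; last 2 first.
- exact/measurable_funTS/measurable_EFinP.
- by move=> x _; rewrite lee_fin.
by rewrite -hm// [m A]mA0 mule0.
Qed.

Let r_ge0 : P `<< m -> forall x, (0 <= r x)%R.
Proof. by move=> Pm x; rewrite fine_ge0// Radon_Nikodym_SigmaFinite.f_ge0. Qed.

Let rE : P `<< m -> EFin \o r = Radon_Nikodym_SigmaFinite.f P m.
Proof.
move=> Pm; apply/funext => x /=; rewrite fineK//.
exact: Radon_Nikodym_SigmaFinite.f_fin_num.
Qed.

Let mr : P `<< m -> measurable_fun [set: T] r.
Proof.
move=> Pm; apply/measurable_EFinP; rewrite rE//.
exact: measurable_int (Radon_Nikodym_SigmaFinite.f_integrable Pm).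
Qed.

Let measurable_convex_comp f E (u : T -> R) : convex_on_nonneg f ->
  measurable_fun E u -> (forall x, (0 <= u x)%R) ->
  measurable_fun E (f \o u).
Proof.
move=> cf mfu u0.
apply: (measurable_comp _ _ (convex_on_nonneg_measurable cf) mfu) => //.
by move=> _ [x _ <-] /=; rewrite in_itv/= u0.
Qed.

Let mscaled f : convex_on_nonneg f ->
  measurable_fun D (fun x => q x / M%:R * f (M%:R * p x / q x))%R.
Proof.
move=> cf; have [mq q0 qQ] := Qq; have [mp p0 pP] := Pp.
apply: measurable_funM.
  by apply: measurable_funM => //; exact: measurable_funTS.
apply: measurable_convex_comp => // [|x]; last first.
  by rewrite divr_ge0 ?mulr_ge0// ltW.
apply: measurable_funM; first by apply/measurable_funTS/measurable_funM.
(* Inversion is continuous on the open half-line, and [q] maps [D] into it. *)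
apply: (@measurable_comp _ _ _ T R R `]0%R, +oo[ (@GRing.inv R) D q) => //.
- by move=> _ [x Dx <-] /=; rewrite in_itv/= andbT.
- apply: open_continuous_measurable_fun => // x.
  by rewrite inE/= in_itv/= andbT => x0; apply: inv_continuous; rewrite gt_eqF.
- exact: measurable_funTS.
Qed.

(** This is [perspective_le] integrated with respect to [mu]; nonnegativity of [f] allows infinite
    integrals throughout. *)
Lemma ge0_integral_convex_le f : convex_on_nonneg f ->
  (forall x, (0 <= x)%R -> (0 <= f x)%R) -> P `<< Q ->
  \int[m]_x (f (r x))%:E <=
    \int[mu]_(x in D) (q x / M%:R * f (M%:R * p x / q x))%:E
    + ((1 - M%:R^-1) * f 0%R)%:E.
Proof.
move=> cf f0 PQ; have Pm := null_dominates_trans PQ dominated_scaled_density.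
have [mq q0 qQ] := Qq; have [mp p0 pP] := Pp; have [mh' h0 hm] := mh.
have Mpq0 x : (0 <= M%:R * p x / q x)%R by rewrite divr_ge0 ?mulr_ge0// ltW.
(* The second summand of [perspective_le]. It is nonnegative by [q <= M h], and its integral is the
   constant of the conclusion because [h] and [q] both integrate to 1. *)
pose c x := ((h x - q x / M%:R) * f 0%R)%R.
have c0 x : (0 <= c x)%R.
  by rewrite mulr_ge0 ?f0// subr_ge0 ler_pdivrMr// mulrC.
have ih := density_integrable mh; have iq := density_integrable Qq.
have iq' : mu.-integrable [set: T] (fun x => (M%:R^-1)%:E * (q x)%:E).
  exact: integrableZl.
have mfr : measurable_fun [set: T] (fun x => (f (r x))%:E).
  apply/measurable_EFinP/(@measurable_convex_comp f) => //.
    exact: mr.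
  exact: r_ge0.
have cE : \int[mu]_x (c x)%:E = ((1 - M%:R^-1) * f 0%R)%:E.
  transitivity (\int[mu]_x ((f 0%R)%:E *
      ((h x)%:E - (M%:R^-1)%:E * (q x)%:E))).
    apply: eq_integral => x _; rewrite -!EFinM; congr EFin.
    by rewrite /c; ring.
  rewrite integralZl//; last exact: integrableB.
  rewrite integralB// integralZl//.
  by rewrite -hm// -qQ// !probability_setT mule1 [in RHS]mulrC.
(* Extension by zero outside [D] reproduces the conditional in [perspective_le]. *)
pose s := (fun x => (q x / M%:R * f (M%:R * p x / q x))%:E) \_ D.
have ms : measurable_fun [set: T] s.
  by apply/(measurable_restrictT _ mD)/measurable_EFinP/mscaled.
have s0 x : 0 <= s x.
  rewrite /s patchE; case: ifP => // _.
  by rewrite lee_fin mulr_ge0 ?divr_ge0 ?f0// ltW.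
rewrite [X in _ <= X + _]integral_mkcond -cE -ge0_integralD//; last 2 first.
- by move=> x _; rewrite lee_fin.
- apply/measurable_EFinP/measurable_funM => //.
  by apply: measurable_funB => //; exact: measurable_funM.
rewrite (ge0_integral_density mh)//; last first.
  by move=> x; rewrite lee_fin f0// r_ge0.
apply: ae_ge0_le_integral => //.
- by move=> x _; rewrite mule_ge0// lee_fin// f0// r_ge0.
- by apply: emeasurable_funM => //; exact/measurable_EFinP.
- by move=> x _; rewrite adde_ge0 ?lee_fin.
- apply: emeasurable_funD => //; apply/measurable_EFinP/measurable_funM => //.
  by apply: measurable_funB => //; exact: measurable_funM.
have := ae_density_chain Pp mh Pm; have := ae_density_eq0 Pp Qq PQ.
apply: filterS2 => x qp rh _.
have := perspective_le cf MR_gt0 (p0 x) (q0 x) (qh x) qp rh.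
have DE : (x \in D) = (0 < q x)%R by apply/idP/idP; rewrite inE.
rewrite /s patchE DE -EFinM; case: ltP => _.
  by rewrite -EFinD lee_fin.
by rewrite add0e lee_fin add0r.
Qed.

Lemma fdivergence_le_scaled f : convex_on_nonneg f ->
  fdivergence f P m <=
    scaled_fdivergence mu f M P Q p q + ((1 - M%:R^-1) * f 0%R)%:E.
Proof.
move=> cf; rewrite /scaled_fdivergence; case: asboolP => [PQ|_]; last first.
  by rewrite addye// leey.
have Pm := null_dominates_trans PQ dominated_scaled_density.
rewrite /fdivergence; case: asboolP => // _.
have [C C0 fC] := convex_on_nonneg_ge cf.
have [mq q0 qQ] := Qq; have [mp p0 pP] := Pp.
pose g x := (f x + C * (1 + x))%R.
have cg : convex_on_nonneg g := convex_on_nonneg_affine C cf.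
have ir : m.-integrable [set: T] (EFin \o r).
  by rewrite rE//; exact: Radon_Nikodym_SigmaFinite.f_integrable.
have i1 : m.-integrable [set: T] (fun=> 1%:E).
  exact: finite_measure_integrable_cst.
have m1 : \int[m]_x 1%:E = 1.
  by rewrite integral_cst// mul1e; exact: probability_setT.
have r1 : \int[m]_x (EFin \o r) x = 1.
  rewrite rE//; apply: etrans (probability_setT P); apply/esym.
  exact: (Radon_Nikodym_SigmaFinite.f_integral Pm measurableT).
have icr : m.-integrable [set: T] (EFin \o (fun x => C * (1 + r x))%R).
  rewrite (_ : _ \o _ = fun x => C%:E * (1%:E + (EFin \o r) x)).
    by apply: integrableZl => //; exact: integrableD.
  by apply/funext => x.
(* Since [r] has [m]-integral 1, the added term [C * (1 + r)] contributes exactly [2 C]. *)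
have -> : \int[m]_x (f (fine (Radon_Nikodym_SigmaFinite.f P m x)))%:E =
    \int[m]_x (g (r x))%:E - (C * 2)%:E.
  transitivity (\int[m]_x (g (r x) - C * (1 + r x))%:E).
    by apply: eq_integral => x _; rewrite /g addrK.
  rewrite integralB_nneg//.
  - congr (_ - _).
    transitivity (\int[m]_x (C%:E * (1%:E + (EFin \o r) x))) => //.
    rewrite integralZl//; last exact: integrableD.
    by rewrite integralD// m1 r1 -EFinD -EFinM.
  - by apply: measurable_convex_comp => //; [exact: mr|exact: r_ge0].
  - by move=> x _; rewrite mulr_ge0// addr_ge0// r_ge0.
  - by move=> x _; apply: fC; exact: r_ge0.
have ipD : mu.-integrable D (EFin \o p).
  exact: integrableS (density_integrable Pp).
have iqD : mu.-integrable D (EFin \o q).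
  exact: integrableS (density_integrable Qq).
(* On [D] this is [q / M] times the added term [C * (1 + M p / q)]. *)
pose l x := (C * (q x / M%:R + p x))%R.
have iMqD : mu.-integrable D (fun x => (M%:R^-1)%:E * (EFin \o q) x).
  exact: integrableZl.
have lE : EFin \o l =
    (fun x => C%:E * ((M%:R^-1)%:E * (EFin \o q) x + (EFin \o p) x)).
  by apply/funext => x /=; rewrite /l [(q x / _)%R]mulrC.
have il : mu.-integrable D (EFin \o l).
  by rewrite lE; apply: integrableZl => //; exact: integrableD.
have -> : \int[mu]_(x in D) (q x / M%:R * f (M%:R * p x / q x))%:E =
    \int[mu]_(x in D) (q x / M%:R * g (M%:R * p x / q x))%:E -
    \int[mu]_(x in D) (l x)%:E.
  rewrite -integralB_nneg//.
  - apply: eq_integral => x; rewrite inE /D/= => qx; congr EFin.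
    by rewrite /g /l; field; rewrite !gt_eqF.
  - exact: (mscaled cg).
  - by move=> x _; rewrite mulr_ge0// addr_ge0// divr_ge0.
  - by move=> x _; rewrite mulr_ge0 ?divr_ge0// fC// divr_ge0// mulr_ge0//.
have lD : \int[mu]_(x in D) (l x)%:E <= (C * (M%:R^-1 + 1))%:E.
  rewrite [leLHS](_ : _ = \int[mu]_(x in D) (EFin \o l) x)// lE.
  rewrite integralZl//; last exact: integrableD.
  rewrite integralD// integralZl// -qQ// -pP// EFinM.
  rewrite lee_wpmul2l ?lee_fin// EFinD leeD ?probability_le1//.
  by rewrite -[leRHS]mule1 lee_wpmul2l ?lee_fin ?invr_ge0 ?probability_le1.
(* As [g 0 = f 0 + C], the added constants balance: [2 C = C (1/M + 1) + (1 - 1/M) C]. Hence the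
   upper bound [lD] is enough to return from [g] to [f]. *)
have := ge0_integral_convex_le cg fC PQ.
have lfin := integrable_fin_num mD il.
move: lD lfin; rewrite -/D /=.
case: (\int[mu]_(x in D) (l x)%:E) => // L; rewrite lee_fin => lD _.
case: (\int[mu]_(x in D) _) => [S| |]; case: (\int[m]_x _) => [G| |] //=.
- by rewrite -!EFinD !lee_fin /g => GS; lra.
- by move=> _; rewrite leNye.
- by move=> _; rewrite leey.
Qed.

End fdivergence.

(** * Construction of the mixture and averaging over [theta] *)

Theorem mainTheorem4 (R : realType) (d : measure_display)
    (T : measurableType d) (mu : {sigma_finite_measure set T -> \bar R})
    (F G : finType) (F_gt0 : (0 < #|F|)%N) (G_gt0 : (0 < #|G|)%N)
    (P : F -> probability T R) (p : F -> T -> R)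
    (Pp : forall theta : F, is_density mu (P theta) (p theta))
    (Q : G -> probability T R) (q : G -> T -> R)
    (Qq : forall alpha : G, is_density mu (Q alpha) (q alpha))
    (j : F -> G) (f : R -> R) (f_convex : convex_on_nonneg f) :
  Jf f P <=
    (#|F|%:R^-1)%:E *
      \sum_(theta : F) scaled_fdivergence mu f #|G|
        (P theta) (Q (j theta)) (p theta) (q (j theta))
    + ((1 - #|G|%:R^-1) * f 0%R)%:E.
Proof.
have M0 : (0 < #|G|%:R :> R)%R by rewrite ltr0n.
have N0 : (0 < #|F|%:R :> R)%R by rewrite ltr0n.
pose h x := (#|G|%:R^-1 * \sum_(a : G) q a x)%R.
have hE x : (#|G|%:R * h x = \sum_(a : G) q a x)%R.
  by rewrite /h mulVKf// gt_eqF.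
have mq a : measurable_fun [set: T] (q a) by case: (Qq a).
have q0 a x : (0 <= q a x)%R by case: (Qq a).
have h0 x : (0 <= h x)%R by rewrite mulr_ge0 ?invr_ge0 ?(ltW M0)// sumr_ge0.
have mh : measurable_fun [set: T] h.
  by apply: measurable_funM => //; exact: measurable_sum.
have h1 : \int[mu]_x (h x)%:E = 1.
  transitivity (\int[mu]_x ((#|G|%:R^-1)%:E * \sum_(a : G) (q a x)%:E)).
    by apply: eq_integral => x _; rewrite /h EFinM sumEFin.
  rewrite ge0_integralZl//; last 2 first.
  - by apply: emeasurable_sum => a; exact/measurable_EFinP.
  - by move=> x _; apply: sume_ge0 => a _; rewrite lee_fin.
  rewrite ge0_integral_sum//; last 2 first.
  - by move=> a; exact/measurable_EFinP.
  - by move=> a x _; rewrite lee_fin.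
  rewrite (eq_bigr (fun=> 1%:E)) => [|a _].
    by rewrite sumEFin sumr_const -EFinM mulVf// gt_eqF.
  by have [_ _ <-//] := Qq a; exact: probability_setT.
have [m mm] := probability_of_density mh h0 h1.
(* [q a] is one of the nonnegative summands of [#|G| * h]. *)
have qh a x : (q a x <= #|G|%:R * h x)%R.
  by rewrite hE (bigD1 a)//= lerDl sumr_ge0.
apply: (@le_trans _ _ ((#|F|%:R^-1)%:E *
    \sum_(theta : F) fdivergence f (P theta) m)).
  by apply: ereal_inf_lbound; exists m.
apply: (@le_trans _ _ ((#|F|%:R^-1)%:E * \sum_(theta : F)
    (scaled_fdivergence mu f #|G| (P theta) (Q (j theta)) (p theta)
       (q (j theta)) + ((1 - #|G|%:R^-1) * f 0%R)%:E))).
  rewrite lee_wpmul2l ?lee_fin ?invr_ge0 ?(ltW N0)//.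
  apply: lee_sum => theta _.
  exact: (fdivergence_le_scaled (Pp theta) (Qq (j theta)) mm).
(* The sum of scaled divergences may be infinite; distributivity holds because the sum of the
   constants is finite. *)
rewrite big_split/= muleDr//; last first.
  by rewrite sumEFin fin_num_adde_defl.
rewrite leeD2l// sumEFin sumr_const -EFinM lee_fin -(mulr_natl (_ * f 0%R)).
by rewrite mulKf// gt_eqF.
Qed.
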